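(* Let $\mathbf{K}_x,\mathbf{M}_x\in\mathbb{R}^{m\times m}$ be symmetric and positive (definite) matrices, let $\alpha>0$ be a real number, and let $\beta_1,\beta_2$ be nonzero real numbers of opposite sign, i.e. $\beta_1\beta_2<0$. Define the block matrices in $\mathbb{R}^{2m\times 2m}$ $$\overline{A} := \begin{bmatrix}|\beta_2|(\mathbf{K}_x+\alpha\mathbf{M}_x) & -\beta_1|\beta_2|\mathbf{M}_x\\ |\beta_1|\beta_2\mathbf{M}_x & -|\beta_1|(\mathbf{K}_x+\alpha\mathbf{M}_x)\end{bmatrix},$$ $$P := \begin{bmatrix}|\beta_2|\big(\mathbf{K}_x+(\alpha+\sqrt{|\beta_1\beta_2|})\mathbf{M}_x\big) & 0\\ 0 & |\beta_1|\big(\mathbf{K}_x+(\alpha+\sqrt{|\beta_1\beta_2|})\mathbf{M}_x\big)\end{bmatrix}.$$ Then the condition number estimate $$\mathrm{cond}_P(P^{-1}\overline{A})\le\sqrt{2}$$ holds.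
   Context: A real square matrix $B$ is called positive if $v^TBv>0$ for all real vectors $v\neq 0$. For a symmetric positive definite matrix $P$, $\|u\|_P=(u^TPu)^{1/2}$, the same symbol $\|\cdot\|_P$ denotes the induced operator norm on matrices, and $\mathrm{cond}_P(P^{-1}\overline{A}) := \|P^{-1}\overline{A}\|_P\,\|\overline{A}^{-1}P\|_P$. *)

(* Defs.v *)
From HB Require Import structures.
From mathcomp Require Import all_boot all_order all_algebra.
From mathcomp Require Import classical_sets reals.

Set Implicit Arguments.
Unset Strict Implicit.
Unset Printing Implicit Defensive.

Import Order.TTheory GRing.Theory Num.Theory.

Local Open Scope classical_set_scope.
Local Open Scope ring_scope.

Section WeightedNorm.
Variables (R : realType) (n : nat).
Implicit Types (B P : 'M[R]_n) (u v : 'cV[R]_n).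

Definition quadform B v : R := (v^T *m B *m v) 0 0.

(* Symmetry is not part of positivity. *)
Definition positivemx B : Prop := forall v, v != 0 -> 0 < quadform B v.

Definition pnorm P u : R := Num.sqrt (quadform P u).

(* The supremum is over a set bounded above whenever P is symmetric positive
   definite; for n = 0 that set is empty and the norm is 0. *)
Definition opnorm P B : R :=
  sup [set pnorm P (B *m v) / pnorm P v | v in [set v | v != 0]].

(* cond_P(P^-1 A); invmx is the inverse only on unitmx. *)
Definition condP P A : R :=
  opnorm P (invmx P *m A) * opnorm P (invmx A *m P).

End WeightedNorm.

Section BlockMatrices.
Variables (R : realType) (m : nat).
Variables (K M : 'M[R]_m) (alpha beta1 beta2 : R).

Definition Abar : 'M[R]_(m + m) :=
  block_mx
    (`|beta2| *: (K + alpha *: M)) (- (beta1 * `|beta2|) *: M)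
    ((`|beta1| * beta2) *: M)      (- `|beta1| *: (K + alpha *: M)).

Definition Pmx : 'M[R]_(m + m) :=
  let S := K + (alpha + Num.sqrt `|beta1 * beta2|) *: M in
  block_mx (`|beta2| *: S) 0
           0               (`|beta1| *: S).

End BlockMatrices.

(* Main.v *)
Require Import Defs.
From HB Require Import structures.
From mathcomp Require Import all_boot all_order all_algebra.
From mathcomp Require Import classical_sets reals.
From mathcomp Require Import boolp ring lra.
Set Implicit Arguments.
Unset Strict Implicit.

Import Order.TTheory GRing.Theory Num.Theory.
Local Open Scope ring_scope.

(* Put H = K + alpha M, g = sqrt |beta1 beta2|, S = H + g M, mu = S^-1 M and
   h = S^-1 H = 1 - g mu.  Then T = P^-1 Abar maps (x, y) to
   (h x - beta1 mu y, beta2 mu x - h y).  As h and mu commute and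
   |beta2| beta1 + |beta1| beta2 = 0, the cross terms of |T (x, y)|_P^2 cancel,
   leaving |beta2| E x + |beta1| E y with E x = |h x|_S^2 + |g mu x|_S^2.
   Since h x + g mu x = x, the parallelogram law gives E x >= |x|_S^2 / 2, and
   E x <= |x|_S^2 because <h x, g mu x>_S >= 0.  Hence
   |v|_P^2 / 2 <= |T v|_P^2 <= |v|_P^2 for all v. *)

(** * Bilinear forms, positivity and operator norm bounds *)

Section BilinearForm.
Variables (R : realType) (n : nat).
Implicit Types (B C : 'M[R]_n) (u v w : 'cV[R]_n).

Definition bilinform B u v : R := (u^T *m B *m v) 0 0.

Lemma quadformE B v : quadform B v = bilinform B v v.
Proof. by []. Qed.

Lemma bilinformDl B u v w :
  bilinform B (u + v) w = bilinform B u w + bilinform B v w.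
Proof. by rewrite /bilinform linearD /= !mulmxDl mxE. Qed.

Lemma bilinformDr B u v w :
  bilinform B u (v + w) = bilinform B u v + bilinform B u w.
Proof. by rewrite /bilinform mulmxDr mxE. Qed.

Lemma bilinformZl B a u v : bilinform B (a *: u) v = a * bilinform B u v.
Proof. by rewrite /bilinform linearZ /= -!scalemxAl mxE. Qed.

Lemma bilinformZr B a u v : bilinform B u (a *: v) = a * bilinform B u v.
Proof. by rewrite /bilinform -scalemxAr mxE. Qed.

Lemma bilinformC B u v : B^T = B -> bilinform B u v = bilinform B v u.
Proof.
move=> B_sym; rewrite /bilinform.
suff -> : v^T *m B *m u = (u^T *m B *m v)^T by rewrite [RHS]mxE.
by rewrite !trmx_mul trmxK B_sym mulmxA.
Qed.

Lemma eq_bilinformr B C u v w :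
  B *m v = C *m w -> bilinform B u v = bilinform C u w.
Proof. by rewrite /bilinform -!mulmxA => ->. Qed.

Lemma quadformD B u v : B^T = B ->
  quadform B (u + v) = quadform B u + 2 * bilinform B u v + quadform B v.
Proof.
move=> B_sym; rewrite !quadformE bilinformDl !bilinformDr (bilinformC v u) //.
ring.
Qed.

Lemma quadformZ B a v : quadform B (a *: v) = a ^+ 2 * quadform B v.
Proof. by rewrite !quadformE bilinformZl bilinformZr expr2 mulrA. Qed.

Lemma quadform_ge0 B v : positivemx B -> 0 <= quadform B v.
Proof.
move=> B_pos; have [->|/B_pos/ltW //] := eqVneq v 0.
by rewrite /quadform mulmx0 mxE.
Qed.

Lemma positivemxD B C : positivemx B -> positivemx C -> positivemx (B + C).
Proof.
move=> B_pos C_pos v v0.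
by rewrite /quadform mulmxDr mulmxDl mxE addr_gt0 ?B_pos ?C_pos.
Qed.

Lemma positivemxZ a B : 0 < a -> positivemx B -> positivemx (a *: B).
Proof.
move=> a0 B_pos v v0.
by rewrite /quadform -scalemxAr -scalemxAl mxE mulr_gt0 ?B_pos.
Qed.

Lemma unitmx_inj B : (forall v, B *m v = 0 -> v = 0) -> B \in unitmx.
Proof.
(* [kermx] is the left kernel, hence the passage to the transpose. *)
move=> B_inj; rewrite -unitmx_tr -row_free_unit -kermx_eq0.
apply/rowV0P => u /sub_kermxP uB; apply: trmx_inj; rewrite trmx0.
by apply: B_inj; rewrite -[B]trmxK -trmx_mul uB trmx0.
Qed.

Lemma positivemx_unit B : positivemx B -> B \in unitmx.
Proof.
move=> B_pos; apply: unitmx_inj => v Bv0; apply/eqP; apply: contraT => /B_pos.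
by rewrite /quadform -mulmxA Bv0 mulmx0 mxE ltxx.
Qed.

Lemma pnorm_gt0 B v : positivemx B -> v != 0 -> 0 < pnorm B v.
Proof. by move=> B_pos /B_pos; rewrite sqrtr_gt0. Qed.

Lemma opnorm_ge0 B C : 0 <= opnorm B C.
Proof.
rewrite /opnorm; set A := (X in sup X).
(* An empty or unbounded set has [sup] equal to 0 by default; otherwise [sup] dominates some
   element, a ratio of square roots. *)
have [hsA|/sup_out -> //] := pselect (has_sup A).
case: (hsA) => -[r Ar] ubA; apply: le_trans (ub_le_sup ubA Ar).
by case: Ar => v _ <-; rewrite divr_ge0 ?sqrtr_ge0.
Qed.

Lemma opnorm_le B C k : positivemx B -> 0 <= k ->
  (forall v, quadform B (C *m v) <= k * quadform B v) ->
  opnorm B C <= Num.sqrt k.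
Proof.
move=> B_pos k0 leC; rewrite /opnorm; set A := (X in sup X).
(* The empty case is that of dimension 0; [ge_sup] needs an element. *)
have [A0|/set0P A0] := eqVneq A set0; first by rewrite A0 sup0 sqrtr_ge0.
apply: ge_sup => // _ [v v0 <-].
rewrite ler_pdivrMr ?pnorm_gt0 // -sqrtrM // ler_wsqrtr //.
Qed.

End BilinearForm.

(** * Norms of the two parts of a split vector *)

Section Splitting.
Variables (R : realType) (n : nat) (H N : 'M[R]_n) (p q : 'cV[R]_n).
Hypotheses (H_sym : H^T = H) (N_sym : N^T = N).
Hypotheses (H_pos : positivemx H) (N_pos : positivemx N).
Hypothesis HpNq : H *m p = N *m q.

(** The cross term is nonnegative: by [HpNq], q^T (H + N) p = q^T N (q + p) = q^T N q + p^T H p. *)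
Lemma quadform_split_le :
  quadform (H + N) q + quadform (H + N) p <= quadform (H + N) (q + p).
Proof.
have S_sym : (H + N)^T = H + N by rewrite linearD /= H_sym N_sym.
have -> : quadform (H + N) (q + p) =
    quadform (H + N) q + quadform (H + N) p +
    2 * (quadform H p + quadform N q).
  rewrite quadformD //; suff -> : bilinform (H + N) q p =
    quadform H p + quadform N q by ring.
  have -> : bilinform (H + N) q p = bilinform N q (p + q).
    by apply: eq_bilinformr; rewrite mulmxDl mulmxDr HpNq addrC.
  rewrite bilinformDr (bilinformC _ _ N_sym) !quadformE; congr (_ + _).
  exact: eq_bilinformr.
by have := quadform_ge0 p H_pos; have := quadform_ge0 q N_pos; lra.
Qed.

Lemma quadform_split_ge :
  quadform (H + N) (q + p) <= 2 * (quadform (H + N) q + quadform (H + N) p).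
Proof.
have S_sym : (H + N)^T = H + N by rewrite linearD /= H_sym N_sym.
(* The form at q - p is the defect in the parallelogram law. *)
have := quadform_ge0 (q + (-1) *: p) (positivemxD H_pos N_pos).
by rewrite !quadformD // bilinformZr quadformZ; lra.
Qed.

End Splitting.

Lemma quadform_block_diag (R : realType) (m : nat) (B C : 'M[R]_m)
    (x y : 'cV[R]_m) :
  quadform (block_mx B 0 0 C) (col_mx x y) = quadform B x + quadform C y.
Proof.
rewrite /quadform -mulmxA mul_block_col !mul0mx addr0 add0r.
by rewrite tr_col_mx mul_row_col mxE !mulmxA.
Qed.

(** * The preconditioned operator and its two-sided bound *)

Section Preconditioner.
Variables (R : realType) (m : nat) (K M : 'M[R]_m) (alpha beta1 beta2 : R).
Hypotheses (K_sym : K^T = K) (K_pos : positivemx K).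
Hypotheses (M_sym : M^T = M) (M_pos : positivemx M).
Hypotheses (alpha_gt0 : 0 < alpha) (beta_opp : beta1 * beta2 < 0).

Let g := Num.sqrt `|beta1 * beta2|.
Let H := K + alpha *: M.
Let S := H + g *: M.
Let mu := invmx S *m M.
Let h := invmx S *m H.
Let P := Pmx K M alpha beta1 beta2.
Let A := Abar K M alpha beta1 beta2.

Let g_gt0 : 0 < g.
Proof. by rewrite sqrtr_gt0 normr_gt0 lt_eqF. Qed.

Let g2E : g ^+ 2 = `|beta1| * `|beta2|.
Proof. by rewrite sqr_sqrtr // normrM. Qed.

Let b1_gt0 : 0 < `|beta1|.
Proof.
by rewrite normr_gt0; apply: contraTneq beta_opp => ->; rewrite mul0r ltxx.
Qed.

Let b2_gt0 : 0 < `|beta2|.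
Proof.
by rewrite normr_gt0; apply: contraTneq beta_opp => ->; rewrite mulr0 ltxx.
Qed.

Let cross0 : `|beta2| * beta1 + `|beta1| * beta2 = 0.
Proof.
(* [ring] settles the mixed signs; the two equal-sign cases left contradict [beta_opp]. *)
have [b1|b1] := ger0P beta1; have [b2|b2] := ger0P beta2; try ring.
- by have := mulr_ge0 b1 b2; rewrite leNgt beta_opp.
- by move: b2; rewrite -(nmulr_rgt0 _ b1) => /(lt_trans beta_opp); rewrite ltxx.
Qed.

Let H_sym : H^T = H.
Proof. by rewrite linearD linearZ /= K_sym M_sym. Qed.

Let N_sym : (g *: M)^T = g *: M.
Proof. by rewrite linearZ /= M_sym. Qed.

Let S_sym : S^T = S.
Proof. by rewrite linearD /= H_sym N_sym. Qed.

Let H_pos : positivemx H.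
Proof. exact/positivemxD/positivemxZ. Qed.

Let N_pos : positivemx (g *: M).
Proof. exact: positivemxZ. Qed.

Let S_pos : positivemx S.
Proof. exact: positivemxD. Qed.

Let S_unit : S \in unitmx.
Proof. exact: positivemx_unit. Qed.

Let PE : P = block_mx (`|beta2| *: S) 0 0 (`|beta1| *: S).
Proof. by rewrite /P /Pmx /S /H /g scalerDl addrA. Qed.

Let quadformPE x y :
  quadform P (col_mx x y) = `|beta2| * quadform S x + `|beta1| * quadform S y.
Proof.
by rewrite PE quadform_block_diag /quadform -!scalemxAr -!scalemxAl !mxE.
Qed.

Lemma Pmx_positive : positivemx P.
Proof.
move=> v; rewrite -[v]vsubmxK col_mx_eq0 negb_and quadformPE.
case/orP=> /S_pos qv; [apply: ltr_wpDr|apply: ltr_wpDl];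
  by rewrite ?mulr_gt0 ?mulr_ge0 ?quadform_ge0.
Qed.

Let P_unit : P \in unitmx.
Proof. exact/positivemx_unit/Pmx_positive. Qed.

Let SmuE (x : 'cV_m) : S *m (mu *m x) = M *m x.
Proof. by rewrite /mu -mulmxA mulKVmx. Qed.

Let ShE (x : 'cV_m) : S *m (h *m x) = H *m x.
Proof. by rewrite /h -mulmxA mulKVmx. Qed.

Let hE (x : 'cV_m) : h *m x + g *: (mu *m x) = x.
Proof.
apply: (can_inj (mulKmx S_unit)).
by rewrite mulmxDr -scalemxAr ShE SmuE scalemxAl -mulmxDl.
Qed.

(** With N = g M this is H S^-1 N = N S^-1 H: adding N S^-1 N to either side gives N, since S = H +
    N. It supplies [HpNq] for p = g mu x and q = h x. *)
Let h_mu (x : 'cV_m) : H *m (g *: (mu *m x)) = (g *: M) *m (h *m x).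
Proof.
apply: (addIr ((g *: M) *m (g *: (mu *m x)))).
by rewrite -mulmxDl -mulmxDr hE -scalemxAr SmuE -scalemxAl.
Qed.

Let cross_comm x y :
  bilinform S (h *m x) (mu *m y) = bilinform S (mu *m x) (h *m y).
Proof.
rewrite (eq_bilinformr _ (SmuE y)) (eq_bilinformr _ (ShE y)).
rewrite bilinformC // [RHS]bilinformC //.
(* What remains, M h x = H mu x, is [h_mu] with the factor [g] cancelled. *)
apply: eq_bilinformr; apply: (scalerI (lt0r_neq0 g_gt0)).
by rewrite scalemxAl -h_mu -scalemxAr.
Qed.

Let TE (x y : 'cV_m) : invmx P *m A *m col_mx x y =
  col_mx (h *m x - beta1 *: (mu *m y)) (beta2 *: (mu *m x) - h *m y).
Proof.
(* Multiplying by [P] removes its inverse and leaves a blockwise comparison. *)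
apply: (can_inj (mulKmx P_unit)); rewrite -mulmxA mulKVmx //.
rewrite PE /A /Abar !mul_block_col !mul0mx addr0 add0r -/H.
rewrite -!scalemxAl !mulmxBr -!scalemxAr !ShE !SmuE.
by congr col_mx; rewrite scalerBr scalerA !scaleNr // mulrC.
Qed.

Let quadformTE x y :
  quadform P (invmx P *m A *m col_mx x y) =
  `|beta2| * (quadform S (h *m x) + quadform S (g *: (mu *m x))) +
  `|beta1| * (quadform S (h *m y) + quadform S (g *: (mu *m y))).
Proof.
rewrite TE quadformPE -scaleNr -[- (h *m y)]scaleN1r !quadformD //.
rewrite !bilinformZl !bilinformZr !quadformZ cross_comm.
(* Since |beta2| beta1^2 = |beta1| g^2, the mu y term of the first component joins the h y term of
   the second; symmetrically for x. *)
rewrite -(real_normK (num_real beta2)) sqrrN -(real_normK (num_real beta1)) g2E.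
set c := bilinform _ _ _; have c0 : (`|beta2| * beta1 + `|beta1| * beta2) * c = 0.
  by rewrite cross0 mul0r.
apply/eqP; rewrite -subr_eq0; apply/eqP.
(* The two sides differ by exactly -2 (|beta2| beta1 + |beta1| beta2) c. *)
rewrite -[RHS](mulr0 (- 2)) -c0; ring.
Qed.

Lemma precond_le v : quadform P (invmx P *m A *m v) <= quadform P v.
Proof.
rewrite -[v]vsubmxK quadformTE quadformPE.
have le_E x : quadform S (h *m x) + quadform S (g *: (mu *m x)) <=
    quadform S x by rewrite -[in leRHS](hE x); exact/quadform_split_le/h_mu.
by apply: lerD; apply: ler_wpM2l.
Qed.

Lemma precond_ge v : quadform P v <= 2 * quadform P (invmx P *m A *m v).
Proof.
rewrite -[v]vsubmxK quadformTE quadformPE.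
have ge_E x : quadform S x <=
    2 * (quadform S (h *m x) + quadform S (g *: (mu *m x))).
  by rewrite -[in leLHS](hE x); exact: quadform_split_ge.
by rewrite mulrDr !(mulrCA 2); apply: lerD; apply: ler_wpM2l.
Qed.

(** By [precond_ge], a vector killed by [A] has P-norm 0. *)
Lemma Abar_unit : A \in unitmx.
Proof.
apply: unitmx_inj => v Av0; apply/eqP; apply: contraT => /Pmx_positive.
rewrite ltNge; case/negP; apply: le_trans (precond_ge v) _.
by rewrite -mulmxA Av0 /quadform !mulmx0 mxE mulr0.
Qed.

Lemma condP_le : condP P A <= Num.sqrt 2.
Proof.
(* The factor sqrt 1 bounds the norm of P^-1 A, and sqrt 2 that of A^-1 P. *)
have -> : Num.sqrt 2 = Num.sqrt 1 * Num.sqrt 2 :> R by rewrite sqrtr1 mul1r.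
apply: ler_pM; rewrite ?opnorm_ge0 //;
  apply: (opnorm_le Pmx_positive) => // v; first by rewrite mul1r precond_le.
(* At w = A^-1 P v one has P^-1 A w = v, so the lower bound on P^-1 A becomes an upper bound on its
   inverse. *)
have := precond_ge (invmx A *m P *m v).
by rewrite !mulmxA mulmxK ?Abar_unit // mulVmx ?mul1mx.
Qed.

End Preconditioner.

Unset Implicit Arguments.
Set Strict Implicit.

(** The first conjunct guarantees that the [invmx] applied to [Abar] in [condP] is a genuine
    inverse. *)
Theorem theorem3p3 (R : realType) (m : nat) (K M : 'M[R]_m)
    (alpha beta1 beta2 : R)
    (K_sym : K^T = K) (K_pos : positivemx K)
    (M_sym : M^T = M) (M_pos : positivemx M)
    (alpha_gt0 : 0 < alpha) (beta_opp : beta1 * beta2 < 0) :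
  Abar K M alpha beta1 beta2 \in unitmx /\
  condP (Pmx K M alpha beta1 beta2) (Abar K M alpha beta1 beta2)
    <= Num.sqrt 2.
Proof. by split; [apply: Abar_unit | apply: condP_le]. Qed.
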